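(* Consider the system $x_{k+1}=f(x_k,w_k)=g(x_k)+Dw_k$ on the state space $\mathbf{X}$ and suppose that conditions (A1), (A2) and (A3) given in the context hold, with $A$ the matrix in (A2). Then, for every initial state $x_0\in\mathbf{X}$, $$\lim_{k\rightarrow\infty}\mathbb{P}\{x_k\in\mathbf{X}_\infty\}=1,\qquad \mathbf{X}_\infty=\bigoplus_{k=0}^\infty A^kD\mathbf{W}.$$
   Context: Setting. $x_{k+1}=f(x_k,w_k):=g(x_k)+Dw_k$, with $x_k\in\mathbf{X}\subseteq\mathbb{R}^{n_x}$, $w_k\in\mathbf{W}\subseteq\mathbb{R}^{n_w}$, $D$ a real matrix, and $g:\mathbf{X}\to\mathbf{X}$ continuous with $g(0)=0$. $\bigoplus$ denotes Minkowski sum, so $\bigoplus_{k=0}^\infty A^kD\mathbf{W}=\{\sum_{k=0}^\infty A^kDw_k: w_k\in\mathbf{W}\}$. (A1) $\{w_k\in\mathbf{W}:k\in\mathbb{N}\}$ is a zero mean, i.i.d. disturbance sequence with a non-singular (with respect to Lebesgue measure) probability distribution supported in $\mathbf{W}$, a bounded set containing the origin in its interior; and $\mathbb{P}\{\|w\|\le\lambda\}>0$ for all $\lambda>0$. (A2) There is a bounded set $\mathbf{X}_f\subseteq\mathbf{X}$ containing the origin in its interior such that for all $x\in\mathbf{X}_f$: (i) $f(x,w)\in\mathbf{X}_f$ for all $w\in\mathbf{W}$ (robust invariance); (ii) $f(x,w)=Ax+Dw$, where $A$ is Schur stable and $(A,D)$ is controllable. (A3) The system has an ISS-Lyapunov function,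 in the sense that $\mathbf{X}$ contains the origin in its interior and is robustly invariant ($f(x,w)\in\mathbf{X}$ for all $x\in\mathbf{X}$, $w\in\mathbf{W}$), and at least one of the following holds: (a) there exist a continuous $V:\mathbf{X}\to\mathbb{R}_+$, $\mathcal{K}_\infty$-functions $\alpha_1,\alpha_2,\alpha_3$ and a $\mathcal{K}$-function $\sigma$ such that $\alpha_1(\|x\|)\le V(x)\le\alpha_2(\|x\|)$ and $V(f(x,w))-V(x)\le-\alpha_3(\|x\|)+\sigma(\|w\|)$ for all $x\in\mathbf{X}$, $w\in\mathbf{W}$; (b) there exist a Lipschitz continuous $V:\mathbf{X}\to\mathbb{R}_+$ and $\mathcal{K}_\infty$-functions $\alpha_1,\alpha_2,\alpha_3$ such that $\alpha_1(\|x\|)\le V(x)\le\alpha_2(\|x\|)$ and $V(f(x,0))-V(x)\le-\alpha_3(\|x\|)$ for all $x\in\mathbf{X}$, and either $f$ is Lipschitz continuous on $\mathbf{X}\times\mathbf{W}$ or $f(x,w)=g(x)+w$ with $g$ continuous on $\mathbf{X}$. A $\mathcal{K}$-function is a continuous strictly increasing $\phi:\mathbb{R}_+\to\mathbb{R}_+$ with $\phi(0)=0$; it is a $\mathcal{K}_\infty$-function if in addition $\phi(s)\to\infty$ as $s\to\infty$. *)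

(* Defs.v *)
(* MathComp / MathComp-Analysis. *)
From HB Require Import structures.
From mathcomp Require Import all_boot all_order all_algebra.
From mathcomp Require Import complex.
From mathcomp Require Import all_classical all_reals all_analysis.
Set Implicit Arguments.
Unset Strict Implicit.
Unset Printing Implicit Defensive.
Import Order.TTheory GRing.Theory Num.Theory.
Import numFieldNormedType.Exports.
Local Open Scope classical_set_scope.
Local Open Scope ring_scope.

(* The library norm on 'cV[R]_n is the max norm; it induces the same topology,
   bounded sets and Lipschitz functions as the Euclidean one, so the library
   notions are used for those. *)
Definition enorm (R : realType) (n : nat) (x : 'cV[R]_n) : R :=
  Num.sqrt (\sum_(i < n) x i ord0 ^+ 2).

Section system.
Variables (R : realType) (nx nw : nat).
Implicit Types (X Xf : set 'cV[R]_nx) (W : set 'cV[R]_nw).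
Implicit Types (g : 'cV[R]_nx -> 'cV[R]_nx) (A : 'M[R]_nx) (D : 'M[R]_(nx, nw)).

Definition fstep g D (x : 'cV[R]_nx) (w : 'cV[R]_nw) : 'cV[R]_nx :=
  g x + D *m w.

Fixpoint state (Omega : Type) g D (w : nat -> Omega -> 'cV[R]_nw)
    (x0 : 'cV[R]_nx) (k : nat) (omega : Omega) : 'cV[R]_nx :=
  if k is k'.+1 then fstep g D (state g D w x0 k' omega) (w k' omega) else x0.

Definition robustly_invariant g D W (S : set 'cV[R]_nx) : Prop :=
  forall x w, S x -> W w -> S (fstep g D x w).

Definition Xinf A D W : set 'cV[R]_nx :=
  [set x | exists2 u : nat -> 'cV[R]_nw, forall k, W (u k) &
           [series A ^+ k *m (D *m u k)]_k @ \oo --> x].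

Definition schur_stable A : Prop :=
  forall z : R[i], eigenvalue (map_mx (real_complex R) A) z -> `|z| < 1.

(* Kalman rank condition on [D, A D, ..., A^(nx - 1) D]. *)
Definition controllable A D : Prop :=
  \rank (\mxrow_(k < nx) (A ^+ k *m D)) = nx.

End system.

Section probability.
Variables (R : realType) (d : measure_display) (Omega : measurableType d).
Variable P : probability Omega R.

(* Inner probability.  It equals the probability of E whenever E is an event of
   the completed probability space (see inner_probE); for an arbitrary E it is a
   lower bound of the probability of E in every extension of P measuring E. *)
Definition inner_prob (E : set Omega) : \bar R :=
  ereal_sup [set P F | F in [set F | measurable F /\ F `<=` E]].

Lemma inner_probE (E1 E E2 : set Omega) :
  measurable E1 -> measurable E2 -> E1 `<=` E -> E `<=` E2 -> P E1 = P E2 ->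
  inner_prob E = P E1.
Proof.
move=> m1 m2 s1 s2 e12; apply/eqP; rewrite eq_le; apply/andP; split.
  apply: ge_ereal_sup => _ [F [mF FE] <-]; rewrite e12.
  by apply: le_measure; rewrite ?inE//; exact: subset_trans FE s2.
by apply: ereal_sup_ubound; exists E1.
Qed.

Definition borel (n : nat) : set (set 'cV[R]_n) := <<s @open 'cV[R]_n >>.

Definition random_vector (n : nat) (Y : Omega -> 'cV[R]_n) : Prop :=
  forall B, borel B -> measurable (Y @^-1` B).

Definition independent_seq (n : nat) (w : nat -> Omega -> 'cV[R]_n) : Prop :=
  forall (s : seq nat) (B : nat -> set 'cV[R]_n),
    uniq s -> (forall k, borel (B k)) ->
    P (\bigcap_(k in [set` s]) (w k @^-1` B k))
    = (\prod_(k <- s) P (w k @^-1` B k))%E.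

Definition identically_distributed (n : nat) (w : nat -> Omega -> 'cV[R]_n) :
    Prop :=
  forall k B, borel B -> P (w k @^-1` B) = P (w 0%N @^-1` B).

(* Lebesgue outer measure on R^n, by countable covers with closed boxes
   (meaningful for n > 0: in R^0 every box has volume 1). *)
Definition lebesgue_outer (n : nat) (S : set 'cV[R]_n) : \bar R :=
  ereal_inf
    [set (\sum_(0 <= k <oo) (\prod_(i < n) (ab.2 k i ord0 - ab.1 k i ord0))%:E)%E
    | ab in [set ab : (nat -> 'cV[R]_n) * (nat -> 'cV[R]_n) |
        (forall k i, ab.1 k i ord0 <= ab.2 k i ord0) /\
        S `<=` \bigcup_k [set x | forall i,
                            ab.1 k i ord0 <= x i ord0 <= ab.2 k i ord0]]].

(* The law of Y is singular if it is concentrated on a Lebesgue-null set. *)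
Definition singular_law (n : nat) (Y : Omega -> 'cV[R]_n) : Prop :=
  exists N, [/\ borel N, lebesgue_outer N = 0%E & P (Y @^-1` (~` N)) = 0%E].

(* Almost-sure membership in W expresses that the law is supported in W; W need
   not be Borel, as \forall _ \ae allows any subset of a null event. *)
Record disturbance (n : nat) (W : set 'cV[R]_n) (w : nat -> Omega -> 'cV[R]_n) :
    Prop := Disturbance {
  dist_measurable : forall k, random_vector (w k);
  dist_independent : independent_seq w;
  dist_identical : identically_distributed w;
  dist_zero_mean :
    forall k (i : 'I_n), ('E_P[fun omega => w k omega i ord0] = 0)%E;
  dist_nonsingular : forall k, ~ singular_law (w k);
  dist_supported : forall k, \forall omega \ae P, W (w k omega);
  dist_bounded : bounded_set W;
  dist_interior : W° 0;
  dist_small : forall k (lambda : R), 0 < lambda ->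
    (0 < P [set omega | (enorm (w k omega) <= lambda)%R])%E
}.

End probability.

Section lyapunov.
Variables (R : realType) (nx nw : nat).

(* Functions on the nonnegative reals are represented by total functions on R,
   constrained only there. *)
Definition class_K (phi : R -> R) : Prop :=
  [/\ {within `[0, +oo[, continuous phi},
      forall s t : R, 0 <= s -> s < t -> phi s < phi t &
      phi 0 = 0].

Definition class_Kinf (phi : R -> R) : Prop :=
  class_K phi /\ phi s @[s --> +oo] --> +oo.

Record terminal_set (X : set 'cV[R]_nx) (W : set 'cV[R]_nw)
    (g : 'cV[R]_nx -> 'cV[R]_nx) (D : 'M[R]_(nx, nw)) (A : 'M[R]_nx)
    (Xf : set 'cV[R]_nx) : Prop := TerminalSet {
  term_bounded : bounded_set Xf;
  term_subset : Xf `<=` X;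
  term_interior : Xf° 0;
  term_invariant : robustly_invariant g D W Xf;
  term_linear : forall x w, Xf x -> W w -> fstep g D x w = A *m x + D *m w;
  term_schur : schur_stable A;
  term_controllable : controllable A D
}.

Definition lyapunov_bounds (X : set 'cV[R]_nx) (V : 'cV[R]_nx -> R)
    (alpha1 alpha2 : R -> R) : Prop :=
  forall x, X x ->
    [/\ 0 <= V x, alpha1 (enorm x) <= V x & V x <= alpha2 (enorm x)].

Definition iss_lyapunov_a (X : set 'cV[R]_nx) (W : set 'cV[R]_nw)
    (g : 'cV[R]_nx -> 'cV[R]_nx) (D : 'M[R]_(nx, nw)) : Prop :=
  exists (V : 'cV[R]_nx -> R) (alpha1 alpha2 alpha3 sigma : R -> R),
    [/\ {within X, continuous V},
        [/\ class_Kinf alpha1, class_Kinf alpha2 & class_Kinf alpha3],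
        class_K sigma,
        lyapunov_bounds X V alpha1 alpha2 &
        forall x w, X x -> W w ->
          V (fstep g D x w) - V x <= - alpha3 (enorm x) + sigma (enorm w)].

(* The last alternative, f(x, w) = g(x) + w, presupposes nw = nx. *)
Definition iss_lyapunov_b (X : set 'cV[R]_nx) (W : set 'cV[R]_nw)
    (g : 'cV[R]_nx -> 'cV[R]_nx) (D : 'M[R]_(nx, nw)) : Prop :=
  (exists (V : 'cV[R]_nx -> R) (alpha1 alpha2 alpha3 : R -> R),
    [/\ [lipschitz V x | x in X],
        [/\ class_Kinf alpha1, class_Kinf alpha2 & class_Kinf alpha3],
        lyapunov_bounds X V alpha1 alpha2 &
        forall x, X x -> V (fstep g D x 0) - V x <= - alpha3 (enorm x)])
  /\ ([lipschitz fstep g D xw.1 xw.2 | xw in X `*` W]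
      \/ (exists e : nw = nx,
            forall x w, X x -> W w ->
              fstep g D x w = g x + castmx (e, erefl 1%N) w)
         /\ {within X, continuous g}).

Definition has_iss_lyapunov (X : set 'cV[R]_nx) (W : set 'cV[R]_nw)
    (g : 'cV[R]_nx -> 'cV[R]_nx) (D : 'M[R]_(nx, nw)) : Prop :=
  [/\ X° 0, robustly_invariant g D W X &
      iss_lyapunov_a X W g D \/ iss_lyapunov_b X W g D].

End lyapunov.

(* Main.v *)
Require Import Defs.
From HB Require Import structures.
From mathcomp Require Import all_boot all_order all_algebra.
From mathcomp Require Import complex.
From mathcomp Require Import all_classical all_reals all_analysis.
Set Implicit Arguments.
Unset Strict Implicit.
Unset Printing Implicit Defensive.
Import Order.TTheory GRing.Theory Num.Theory.
Import numFieldNormedType.Exports.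
Local Open Scope classical_set_scope.
Local Open Scope ring_scope.

(** The set T of terminal states that lie in Xinf absorbs the trajectories:
    inside the terminal set one step is x |-> A x + D w, and prepending w to a
    disturbance sequence that generates x yields one that generates A x + D w
    (Xinf_step).  T is moreover a neighbourhood of the origin: by the rank
    condition every x near 0 is a combination of nx disturbances close to 0,
    followed by zeros (Xinf_nbhs0).  It is thus enough that almost every
    trajectory comes within some distance delta of the origin.

    The Lyapunov function provides this.  The sublevel set of V containing x0
    may be enlarged into one that the disturbed dynamics does not leave
    (iss_invariant_sublevel).  In that set V is bounded, and while the state is
    at distance at least delta from 0 and the disturbances have norm at most
    some lambda, V decreases by a fixed amount at each step.  As V is
    nonnegative, there is a number N, the same for every starting state of the
    sublevel set, such that N consecutive disturbances of norm at most lambda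
    force a visit to the delta-ball (iss_visit).  Lyapunov functions of the
    second kind reduce to the first: w acts additively, so that V Lipschitz
    turns the perturbation D w into a term linear in the norm of w
    (iss_lyapunov_b_imp_a).

    Finally, cut time into blocks of length N.  By independence each block
    consists of small disturbances with the same probability p ^ N > 0, where p
    is the probability of one small disturbance, independently of the others.
    Hence none of the first m blocks does with probability (1 - p ^ N) ^ m
    (prob_no_block), which tends to 0.  At time k
    this applies with m = k / N.  The events about blocks are measurable, hence
    bound the inner probability from below even where Xinf is not known to be
    Borel (inner_prob_ge). *)

(** * Norms of matrices and vectors *)

Lemma mx_entry_le_norm (R : realType) (m n : nat) (M : 'M[R]_(m, n)) i j :
  `|M i j| <= `|M|.
Proof.
rewrite {2}/Num.norm/= mx_normrE.
exact: (le_bigmax _ (fun ij : 'I_m * 'I_n => `|M ij.1 ij.2|) (i, j)).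
Qed.

Lemma mx_norm_le (R : realType) (m n : nat) (M : 'M[R]_(m, n)) (c : R) :
  0 <= c -> (forall i j, `|M i j| <= c) -> `|M| <= c.
Proof.
move=> c0 Mc; rewrite /Num.norm/= mx_normrE.
by apply: bigmax_le => // -[i j] _; exact: Mc.
Qed.

Lemma mulmx_norm_le (R : realType) (m n p : nat) (M : 'M[R]_(m, n))
    (B : 'M[R]_(n, p)) :
  `|M *m B| <= n%:R * `|M| * `|B|.
Proof.
apply: mx_norm_le => [|i j]; first by rewrite !mulr_ge0.
rewrite mxE; apply: le_trans (ler_norm_sum _ _ _) _.
rewrite -mulrA mulr_natl -[n in _ *+ n]card_ord -sumr_const.
apply: ler_sum => k _; rewrite normrM.
by apply: ler_pM => //; exact: mx_entry_le_norm.
Qed.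

Lemma mulmx_continuous (R : realType) (m n p : nat) (M : 'M[R]_(m, n)) :
  continuous (fun B : 'M[R]_(n, p) => M *m B).
Proof.
move=> B; apply/(@cvgrPdist_lt _ _ _ (nbhs B) (nbhs_filter B)) => e e0.
have C0 : 0 < n%:R * `|M| + 1 by rewrite ltr_wpDl// mulr_ge0.
near=> B'; rewrite -mulmxBr.
apply: le_lt_trans (mulmx_norm_le _ _) _.
apply: (@le_lt_trans _ _ ((n%:R * `|M| + 1) * `|B - B'|)).
  by rewrite ler_wpM2r// lerDl.
rewrite mulrC -ltr_pdivlMr//; near: B'.
by apply: cvgr_dist_lt => //; rewrite divr_gt0.
Unshelve. all: by end_near. Qed.

Lemma norm_le_enorm (R : realType) (n : nat) (x : 'cV[R]_n) : `|x| <= enorm x.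
Proof.
apply: mx_norm_le => [|i j]; first exact: sqrtr_ge0.
rewrite (ord1 j) -sqrtr_sqr ler_sqrt ?sqr_ge0//.
  by rewrite (bigD1 i)//= lerDl sumr_ge0// => k _; exact: sqr_ge0.
by apply: sumr_ge0 => k _; exact: sqr_ge0.
Qed.

Lemma enorm_le_norm (R : realType) (n : nat) (x : 'cV[R]_n) :
  enorm x <= Num.sqrt n%:R * `|x|.
Proof.
rewrite -[`|x|]ger0_norm// -sqrtr_sqr -sqrtrM// ler_wsqrtr//.
rewrite mulr_natl -[n in _ *+ n]card_ord -sumr_const.
apply: ler_sum => k _; rewrite -real_normK ?num_real//.
by rewrite ler_pXn2r ?nnegrE// mx_entry_le_norm.
Qed.

Lemma enorm_continuous (R : realType) (n : nat) :
  continuous (@enorm R n).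
Proof.
have sumc : continuous (fun x : 'cV[R]_n => \sum_(i < n) x i ord0 ^+ 2).
  apply: (@continuous_big R _ +%R 0 xpredT (@add_continuous R^o)) => i _ x.
  apply: (@continuous_comp _ _ _ (fun x : 'cV[R]_n => x i ord0)
    (fun t : R => t ^+ 2)); first exact: coord_continuous.
  exact: exprn_continuous.
move=> x; apply: (@continuous_comp _ _ _ _ Num.sqrt); first exact: sumc.
exact: sqrt_continuous.
Qed.

Lemma borel_enorm_ball (R : realType) (n : nat) (r : R) :
  borel [set x : 'cV[R]_n | enorm x <= r].
Proof.
rewrite -[X in borel X]setCK -setTD; apply: sigma_algebraCD.
apply: sub_sigma_algebra; rewrite openC.
apply: (preimage_closed _ (@closed_le _ r)).
by move=> x _; exact: enorm_continuous.
Qed.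

(** * The limit set Xinf *)

(** Prepending w to the sequence that generates x multiplies each of the old
    terms by A and adds D w. *)
Lemma Xinf_step (R : realType) (nx nw : nat) (A : 'M[R]_nx)
    (D : 'M[R]_(nx, nw)) (W : set 'cV[R]_nw) x w :
  W w -> Xinf A D W x -> Xinf A D W (A *m x + D *m w).
Proof.
move=> Ww [u Wu ux]; exists (fun k => if k is k'.+1 then u k' else w).
  by case.
rewrite -cvg_shiftS/=.
rewrite (_ : (fun n => _) = fun n =>
    A *m [series A ^+ k *m (D *m u k)]_k n + D *m w).
  apply: cvgD; last exact: cvg_cst.
  exact: (cvg_comp _ _ ux (@mulmx_continuous _ _ _ _ A x)).
apply/funext => n; rewrite /series/= big_nat_recl//= expr0 mul1mx addrC.
congr (_ + _); rewrite mulmx_sumr; apply: eq_bigr => k _.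
by rewrite exprS -mulmxA.
Qed.

(** The Kalman matrix has full row rank, hence a right inverse.  The blocks of
    the image of x under it are disturbances that steer 0 to x in nx steps, and
    they are small when x is, hence admissible.  Since 0 is admissible too, the
    sequence can be continued by zeros, which makes the series finite. *)
Lemma Xinf_nbhs0 (R : realType) (nx nw : nat) (A : 'M[R]_nx)
    (D : 'M[R]_(nx, nw)) (W : set 'cV[R]_nw) :
  controllable A D -> W° 0 -> \forall x \near (0 : 'cV[R]_nx), Xinf A D W x.
Proof.
move=> ctrl W0.
pose K := \mxrow_(k < nx) (A ^+ k *m D).
have KK : K *m pinvmx K = 1%:M by apply: mulmxVp; rewrite /row_free ctrl.
pose v x (k : 'I_nx) : 'cV[R]_nw := submxcol (pinvmx K *m x) k.
have Kv x : \sum_(k < nx) A ^+ k *m D *m v x k = x.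
  by rewrite -mul_mxrow_mxcol submxcolK mulmxA KK mul1mx.
have /nbhs_ballP[e /= e0 We] := W0.
near=> x.
have vW k : W (v x k).
  apply: We; rewrite mx_norm_ball /ball_/= sub0r normrN.
  apply: (@le_lt_trans _ _ `|pinvmx K *m x|).
    by apply: mx_norm_le => // i j; rewrite mxE; exact: mx_entry_le_norm.
  near: x.
  have := @mulmx_continuous _ _ _ 1 (pinvmx K) 0.
  rewrite /continuous_at mulmx0 => /cvgr0_norm_lt; exact.
exists (fun k => if insub k is Some i then v x i else 0).
  move=> k; case: insubP => [i _ _|_]; first exact: vW.
  exact: nbhs_singleton.
apply: cvg_near_cst; exists nx => // n /= nxn.
rewrite /series/= (big_cat_nat _ nxn)//= [X in _ + X]big_nat_cond.
rewrite [X in _ + X]big1 ?addr0 => [|k /andP[/andP[nk _] _]]; last first.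
  by rewrite insubF ?mulmx0// ltnNge nk.
rewrite big_mkord -[RHS]Kv; apply: eq_bigr => k _.
by rewrite insubT//= => kn; rewrite mulmxA; congr (_ *m v x _); exact: val_inj.
Unshelve. all: by end_near. Qed.
(** * Comparison functions *)

Lemma class_K_le (R : realType) (phi : R -> R) s t :
  class_K phi -> 0 <= s -> s <= t -> phi s <= phi t.
Proof.
move=> [_ mono _] s0; rewrite le_eqVlt => /predU1P[->//|st].
exact/ltW/mono.
Qed.

Lemma class_K_gt0 (R : realType) (phi : R -> R) t :
  class_K phi -> 0 < t -> 0 < phi t.
Proof. by move=> [_ mono phi0] t0; rewrite -phi0; exact: mono. Qed.

Lemma class_K_small (R : realType) (phi : R -> R) e :
  class_K phi -> 0 < e -> exists2 t, 0 < t & phi t <= e.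
Proof.
move=> [cphi _ phi0] e0.
have /subspace_continuousP/(_ 0) := cphi.
rewrite /= in_itv/= lexx => /(_ isT) /cvgrPdist_lt /(_ e e0).
rewrite near_withinE => /nbhs_ballP[r /= r0 near0].
have r20 : 0 < r / 2 by rewrite divr_gt0.
exists (r / 2) => //; apply: le_trans (ler_norm _) _.
have := near0 (r / 2); rewrite /= /from_subspace phi0 sub0r normrN => H.
apply/ltW/H; last by rewrite in_itv/= andbT ltW.
by rewrite /ball/= sub0r normrN gtr0_norm// ltr_pdivrMr// ltr_pMr// ltr1n.
Qed.

Lemma class_Kinf_large (R : realType) (phi : R -> R) c :
  class_Kinf phi -> exists2 t, 0 <= t & c <= phi t.
Proof.
move=> [_ /cvgryPge/(_ c)] [M [_ phiM]].
exists (Num.max 0 (M + 1)); first by rewrite le_max lexx.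
by apply: phiM; rewrite lt_max ltrDl ltr01 orbT.
Qed.

(** * Consequences of the Lyapunov inequality *)

Lemma lipschitz_within_continuous (R : realType) (n : nat)
    (X : set 'cV[R]_n) (V : 'cV[R]_n -> R) :
  [lipschitz V x | x in X] -> {within X, continuous V}.
Proof.
move=> /pinfty_ex_gt0[M M0 lipV]; apply/subspace_continuousP => x Xx.
apply/cvgrPdist_lt => e e0; rewrite near_withinE.
apply/nbhs_ballP; exists (e / M) => /=; first by rewrite divr_gt0.
rewrite mx_norm_ball => y xy Xy.
have /= := lipV (x, y) (conj Xx Xy).
move=> /le_lt_trans; apply.
by rewrite mulrC -ltr_pdivlMr.
Qed.

(** The states fstep g D x w and fstep g D x 0 differ by D w, whatever g is, so
    V changes between them by at most a multiple of the norm of w.  This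
    multiple is the gain sigma; the summand 1 in its coefficient makes it
    strictly increasing even if D = 0. *)
Lemma iss_lyapunov_b_imp_a (R : realType) (nx nw : nat) (X : set 'cV[R]_nx)
    (W : set 'cV[R]_nw) (g : 'cV[R]_nx -> 'cV[R]_nx) (D : 'M[R]_(nx, nw)) :
  W 0 -> robustly_invariant g D W X ->
  iss_lyapunov_b X W g D -> iss_lyapunov_a X W g D.
Proof.
move=> W0 invX [[V [a1 [a2 [a3 [lipV Ka bV decV]]]]] _].
have contV := lipschitz_within_continuous lipV.
have /pinfty_ex_gt0[M M0 lipM] := lipV.
have C0 : 0 < nw%:R * `|D| + 1 by rewrite ltr_wpDl// mulr_ge0.
pose C := M * (nw%:R * `|D| + 1).
have Cgt0 : 0 < C by rewrite mulr_gt0.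
exists V, a1, a2, a3, (fun s => C * s); split => //.
  split; last by rewrite mulr0.
    by apply: continuous_subspaceT => s; exact: mulrl_continuous.
  by move=> s t _ st; rewrite ltr_pM2l.
move=> x w Xx Ww.
have Xw := invX _ _ Xx Ww; have X0 := invX _ _ Xx W0.
have -> : V (fstep g D x w) - V x =
    (V (fstep g D x 0) - V x) + (V (fstep g D x w) - V (fstep g D x 0)).
  by rewrite [RHS]addrC addrA subrK.
apply: lerD; first exact: decV.
apply: le_trans (ler_norm _) _.
apply: le_trans (lipM (fstep g D x w, fstep g D x 0) (conj Xw X0)) _ => /=.
rewrite /fstep mulmx0 addr0 addrAC subrr add0r -mulrA ler_pM2l//.
apply: le_trans (mulmx_norm_le _ _) _.
apply: ler_pM => //; first by rewrite lerDl.
exact: norm_le_enorm.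
Qed.

(** Let s bound the gain term on W, and let r satisfy s <= a3 r.  Outside the
    ball of radius r the decrease a3 outweighs the gain, so V does not grow;
    inside it V is at most a2 r, so that after one step it is at most
    a2 r + s. *)
Lemma iss_invariant_sublevel (R : realType) (nx nw : nat) (X : set 'cV[R]_nx)
    (W : set 'cV[R]_nw) (g : 'cV[R]_nx -> 'cV[R]_nx) (D : 'M[R]_(nx, nw))
    (V : 'cV[R]_nx -> R) (a1 a2 a3 sigma : R -> R) (c0 : R) :
  robustly_invariant g D W X ->
  class_K a2 -> class_Kinf a3 -> class_K sigma -> bounded_set W ->
  lyapunov_bounds X V a1 a2 ->
  (forall x w, X x -> W w ->
     V (fstep g D x w) - V x <= - a3 (enorm x) + sigma (enorm w)) ->
  exists2 c, c0 <= c &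
    robustly_invariant g D W (X `&` [set x | V x <= c]).
Proof.
move=> invX K2 Ki3 Ks bW bV dec; have [K3 _] := Ki3.
have [M M0 WM] := pinfty_ex_gt0 bW.
pose s := sigma (Num.sqrt nw%:R * M).
have sW w : W w -> sigma (enorm w) <= s.
  move=> Ww; apply: class_K_le => //; first exact: sqrtr_ge0.
  apply: le_trans (enorm_le_norm _) _.
  by rewrite ler_wpM2l ?sqrtr_ge0//; exact: WM.
have [r r0 sr] := class_Kinf_large s Ki3.
exists (Num.max c0 (a2 r + s)); first by rewrite le_max lexx.
move=> x w [Xx /= Vx] Ww; split; first exact: invX.
have := dec _ _ Xx Ww; rewrite lerBlDr => decx.
have := sW _ Ww => sw.
have x0 : 0 <= enorm x by exact: sqrtr_ge0.
have [rx|/ltW xr] := leP r (enorm x).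
  apply: le_trans decx _; apply: le_trans Vx; rewrite gerDr.
  rewrite addrC subr_le0; apply: le_trans sw _; apply: le_trans sr _.
  exact: class_K_le.
apply: le_trans decx _; rewrite le_max; apply/orP; right.
have [_ _ V2] := bV _ Xx.
rewrite addrC lerD//; first by apply: le_trans V2 _; exact: class_K_le.
rewrite -[leRHS]add0r lerD// oppr_le0.
by have [_ _ <-] := K3; exact: class_K_le.
Qed.

(** As long as the state stays out of the delta-ball, disturbances whose gain is
    at most half of a3 delta make V decrease by at least that half at each
    step.  The bound N on the length of such a stretch depends on the initial
    state only through the bound c on V: this uniformity is what allows blocks
    of fixed length to be used. *)
Lemma iss_visit (R : realType) (nx nw : nat) (X : set 'cV[R]_nx)
    (W : set 'cV[R]_nw) (g : 'cV[R]_nx -> 'cV[R]_nx) (D : 'M[R]_(nx, nw))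
    (V : 'cV[R]_nx -> R) (a3 sigma : R -> R) (c delta : R) :
  class_K a3 -> class_K sigma -> (forall x, X x -> 0 <= V x) ->
  (forall x w, X x -> W w ->
     V (fstep g D x w) - V x <= - a3 (enorm x) + sigma (enorm w)) ->
  0 < delta ->
  exists (N : nat) (lambda : R), [/\ (0 < N)%N, 0 < lambda &
    forall (y : nat -> 'cV[R]_nx) (u : nat -> 'cV[R]_nw),
      (forall k, X (y k)) -> (forall k, W (u k)) ->
      (forall k, y k.+1 = fstep g D (y k) (u k)) -> V (y 0%N) <= c ->
      (forall k, (k < N)%N -> enorm (u k) <= lambda) ->
      exists2 k, (k <= N)%N & enorm (y k) < delta].
Proof.
move=> K3 Ks V0 dec delta0.
pose eta := a3 delta / 2.
have eta0 : 0 < eta by rewrite divr_gt0// class_K_gt0.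
have [lambda lambda0 slambda] := class_K_small Ks eta0.
(* N steps of decrease eta bring V from c to a negative value. *)
pose N := (Num.truncn (`|c| / eta)).+1.
have cN : c < N%:R * eta.
  rewrite -ltr_pdivrMr//; apply: le_lt_trans (truncnS_gt _).
  by rewrite ler_pM2r ?invr_gt0// ler_norm.
exists N, lambda; split => // y u Xy Wu yS yc ul.
apply: contrapT => none.
have far k : (k <= N)%N -> delta <= enorm (y k).
  by move=> kN; rewrite leNgt; apply/negP => yk; apply: none; exists k.
have Vdec k : (k <= N)%N -> V (y k) <= c - k%:R * eta.
  elim: k => [|k IH] kN; first by rewrite mul0r subr0.
  have := dec _ _ (Xy k) (Wu k); rewrite -yS lerBlDr => /le_trans; apply.
  rewrite addrC -[k.+1%:R]natr1 mulrDl mul1r opprD [leRHS]addrA lerD//.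
    exact/IH/ltnW.
  have -> : - eta = - a3 delta + eta.
    by rewrite [a3 delta](splitr (a3 delta)) opprD subrK.
  rewrite lerD// ?lerN2.
    by apply: class_K_le => //; [exact: ltW|exact/far/ltnW].
  apply: le_trans slambda; apply: class_K_le => //; first exact: sqrtr_ge0.
  exact: ul.
have := le_trans (V0 _ (Xy N)) (Vdec _ (leqnn N)).
by rewrite leNgt subr_lt0 cN.
Qed.

(** * Independent blocks *)

(** The product rule is only known for the events B k, not for complements of
    blocks, so the induction on m carries along an intersection of events B k
    at times not before the end of the first m blocks.  Excluding block m
    subtracts the part where block m occurs, and that part is again of the
    carried form, with the times of block m added to s. *)
Lemma prob_no_block (R : realType) (d : measure_display)
    (Omega : measurableType d) (P : probability Omega R)
    (B : nat -> set Omega) (p : R) (N : nat) :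
  (forall k, measurable (B k)) ->
  (forall s : seq nat, uniq s ->
     P (\bigcap_(k in [set` s]) B k) = (p ^+ size s)%:E) ->
  forall (m : nat) (s : seq nat),
    uniq s -> (forall k, k \in s -> (m * N <= k)%N) ->
    P (~` (\bigcup_(j in `I_m) \bigcap_(k in [set` iota (j * N) N]) B k)
       `&` \bigcap_(k in [set` s]) B k)
    = ((1 - p ^+ N) ^+ m * p ^+ size s)%:E.
Proof.
move=> mB indB; pose block j := \bigcap_(k in [set` iota (j * N) N]) B k.
have mcap (s : seq nat) : measurable (\bigcap_(k in [set` s]) B k).
  by apply: fin_bigcap_measurable => // k _; exact: mB.
have mblock j : measurable (block j) by exact: mcap.
elim=> [|m IH] s us sm.
  by rewrite II0 bigcup_set0 setC0 setTI indB// expr0 mul1r.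
have sm' k : k \in s -> (m * N <= k)%N.
  by move=> /sm; apply: leq_trans; rewrite leq_mul2r leqnSn orbT.
set F := ~` _ in IH *.
have mF : measurable F.
  by apply: measurableC; apply: bigcup_measurable => j _; exact: mblock.
rewrite (_ : ~` _ `&` _ = (F `&` \bigcap_(k in [set` s]) B k) `\` block m);
  last first.
  rewrite IIS bigcup_setU bigcup_set1 setCU -/block.
  by rewrite -setIA [_ `&` \bigcap_(_ in _) _]setIC setIA.
have : P (F `&` \bigcap_(k in [set` s]) B k) =
    (P ((F `&` \bigcap_(k in [set` s]) B k) `\` block m) +
     P ((F `&` \bigcap_(k in [set` s]) B k) `&` block m))%E.
  by apply: measureDI => //; exact: measurableI.
rewrite IH// -[_ `&` _ `&` block m]setIA.
have -> : \bigcap_(k in [set` s]) B k `&` block m =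
    \bigcap_(k in [set` s ++ iota (m * N) N]) B k.
  by rewrite -bigcap_setU; congr bigcap; apply/seteqP; split => k /=;
    rewrite mem_cat => /orP.
rewrite IH; last 2 first.
- rewrite cat_uniq us iota_uniq andbT/=; apply/hasPn => k.
  rewrite mem_iota => /andP[_ kN]; apply/negP => /sm.
  by rewrite mulSn addnC leqNgt kN.
- move=> k; rewrite mem_cat mem_iota => /orP[/sm'//|/andP[]//].
rewrite size_cat size_iota => /eqP.
rewrite -[P _]fineK ?fin_num_measure//; last first.
  by apply: measurableD => //; exact: measurableI.
rewrite -EFinD eqe -subr_eq => /eqP H; congr EFin.
by rewrite -H exprD exprS -mulrA mulrBl mul1r [p ^+ N * _]mulrC mulrA.
Qed.

(** An inclusion valid almost surely is enough: the exceptional event can be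
    removed from F without changing its probability. *)
Lemma inner_prob_ge (R : realType) (d : measure_display)
    (Omega : measurableType d) (P : probability Omega R) (F E : set Omega) :
  measurable F -> (\forall omega \ae P, F omega -> E omega) ->
  (P F <= inner_prob P E)%E.
Proof.
move=> mF [Z [mZ PZ FEZ]].
have -> : P F = P (F `\` Z).
  have PFZ : P (F `&` Z) = 0%E.
    by apply: subset_measure0 PZ => //; exact: measurableI.
  by rewrite -[RHS]adde0 -PFZ; exact: measureDI.
apply: ereal_sup_ubound; exists (F `\` Z) => //; split.
  exact: measurableD.
move=> omega [Fo nZ]; apply: contrapT => nE.
by apply/nZ/FEZ => FE; exact/nE/FE.
Qed.

Lemma inner_prob_le1 (R : realType) (d : measure_display)
    (Omega : measurableType d) (P : probability Omega R) (E : set Omega) :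
  (inner_prob P E <= 1)%E.
Proof. by apply: ge_ereal_sup => _ [F [mF _] <-]; exact: probability_le1. Qed.

(** * Convergence in probability to Xinf *)

Lemma state_invariant (R : realType) (nx nw : nat) (Omega : Type)
    (W : set 'cV[R]_nw) (g : 'cV[R]_nx -> 'cV[R]_nx) (D : 'M[R]_(nx, nw))
    (w : nat -> Omega -> 'cV[R]_nw) (S : set 'cV[R]_nx) (x0 : 'cV[R]_nx)
    (omega : Omega) (k l : nat) :
  robustly_invariant g D W S -> (forall j, W (w j omega)) -> (k <= l)%N ->
  S (state g D w x0 k omega) -> S (state g D w x0 l omega).
Proof.
move=> invS Wo + Sk; elim: l => [|l IH]; first by rewrite leqn0 => /eqP <-.
rewrite leq_eqVlt ltnS => /predU1P[<-//|kl].
by apply: invS => //; exact: IH.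
Qed.

Theorem corollary1 (R : realType) (nx nw : nat)
    (d : measure_display) (Omega : measurableType d) (P : probability Omega R)
    (X : set 'cV[R]_nx) (W : set 'cV[R]_nw)
    (g : 'cV[R]_nx -> 'cV[R]_nx) (D : 'M[R]_(nx, nw)) (A : 'M[R]_nx)
    (w : nat -> Omega -> 'cV[R]_nw)
    (g_maps : forall x, X x -> X (g x))
    (g_continuous : {within X, continuous g})
    (g0 : g 0 = 0)
    (A1 : disturbance P W w)
    (A2 : exists Xf : set 'cV[R]_nx, terminal_set X W g D A Xf)
    (A3 : has_iss_lyapunov X W g D)
    (x0 : 'cV[R]_nx) (x0X : X x0) :
  inner_prob P [set omega | Xinf A D W (state g D w x0 k omega)]
    @[k --> \oo] --> 1%E.
Proof.
have W0 : W 0 := nbhs_singleton (dist_interior A1).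
have [_ invX ab] := A3.
have [V [a1 [a2 [a3 [sigma [_ [_ [K2 _] Ki3] Ks bV dec]]]]]] :
    iss_lyapunov_a X W g D by case: ab => // b; exact: iss_lyapunov_b_imp_a.
have [Xf tXf] := A2.
pose T := Xf `&` Xinf A D W.
have invT : robustly_invariant g D W T.
  move=> x u [fx ix] Wu; split; first exact: (term_invariant tXf).
  by rewrite (term_linear tXf)//; exact: Xinf_step.
have [delta delta0 Tdelta] : exists2 delta, 0 < delta &
    forall x, enorm x < delta -> T x.
  have : \forall x \near (0 : 'cV[R]_nx), T x.
    apply: filterI; first exact: (term_interior tXf).
    exact: Xinf_nbhs0 (term_controllable tXf) (dist_interior A1).
  move=> /nbhs_ballP[r /= r0 rT]; exists r => // x xr; apply: rT.
  rewrite mx_norm_ball /ball_/= sub0r normrN.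
  exact: le_lt_trans (norm_le_enorm x) xr.
have [c cx0 invS] := iss_invariant_sublevel (V x0) invX K2 Ki3 Ks
  (dist_bounded A1) bV dec.
have V0 x : X x -> 0 <= V x by move=> /bV[].
have [N [lambda [N0 lambda0 visit]]] := iss_visit c Ki3.1 Ks V0 dec delta0.
pose B k := w k @^-1` [set v | enorm v <= lambda].
have mB k : measurable (B k).
  by apply: (dist_measurable A1); exact: borel_enorm_ball.
pose p := fine (P (B 0%N)).
have PB0 : P (B 0%N) = p%:E by rewrite fineK// fin_num_measure.
have p0 : 0 < p by rewrite -lte_fin -PB0; exact: (dist_small A1).
have p1 : p <= 1 by rewrite -lee_fin -PB0; exact: probability_le1.
have indB (s : seq nat) : uniq s ->
    P (\bigcap_(k in [set` s]) B k) = (p ^+ size s)%:E.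
  move=> us.
  rewrite (dist_independent A1 (B := fun=> [set v | enorm v <= lambda]))//;
    last by move=> _; exact: borel_enorm_ball.
  elim: s {us} => [|k s IH]; first by rewrite big_nil.
  rewrite big_cons IH (dist_identical A1); last exact: borel_enorm_ball.
  by rewrite -/(B 0%N) PB0 exprS EFinM.
pose calm m := \bigcup_(j in `I_m) \bigcap_(k in [set` iota (j * N) N]) B k.
have mcalm m : measurable (calm m).
  apply: bigcup_measurable => j _.
  by apply: fin_bigcap_measurable => // k _; exact: mB.
have Pcalm m : P (calm m) = (1 - (1 - p ^+ N) ^+ m)%:E.
  rewrite -[calm m]setCK probability_setC; last exact: measurableC.
  have := prob_no_block mB indB (N := N) (m := m) (s := [::]) isT.
  by rewrite set_nil bigcap_set0 setIT mulr1 EFinB => ->.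
have Wae : \forall omega \ae P, forall k, W (w k omega).
  by apply: ae_foralln => k; exact: (dist_supported A1).
have lower k : (P (calm (k %/ N)%N) <=
    inner_prob P [set omega | Xinf A D W (state g D w x0 k omega)])%E.
  apply: inner_prob_ge => //; apply: filterS Wae => omega Wo [j /= jk calmj].
  (* A block of small disturbances that ends by time k leads to T, where the
     state remains. *)
  have jNk : (j * N + N <= k)%N.
    rewrite addnC -mulSn; apply: leq_trans (leq_divM k N).
    by rewrite leq_mul2r jk orbT.
  have Sstate i : (X `&` [set x | V x <= c]) (state g D w x0 i omega).
    exact: (@state_invariant _ _ _ _ _ _ _ _ _ _ _ 0 i invS Wo).
  have [i|//|i|||i iN /Tdelta Ti] := visit
    (fun i => state g D w x0 (j * N + i) omega)
    (fun i => w (j * N + i)%N omega).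
  - by have [] := Sstate (j * N + i)%N.
  - by rewrite addnS.
  - by have [] := Sstate (j * N + 0)%N.
  - by move=> i iN; apply: calmj; rewrite /= mem_iota leq_addr ltn_add2l.
  have jNik : (j * N + i <= k)%N by apply: leq_trans jNk; rewrite leq_add2l.
  by have [] := state_invariant invT Wo jNik Ti.
have q1 : `|1 - p ^+ N| < 1.
  rewrite ger0_norm; last by rewrite subr_ge0 exprn_ile1// ltW.
  by rewrite ltrBlDr ltrDl exprn_gt0.
have Pcalm1 : P (calm (k %/ N)%N) @[k --> \oo] --> 1%E.
  under eq_fun do rewrite Pcalm.
  apply: cvg_EFin; first exact: nearW.
  rewrite /= -[X in _ --> X]subr0; apply: cvgB; first exact: cvg_cst.
  apply: (@cvg_comp _ _ _ (fun k => k %/ N)%N (fun m => (1 - p ^+ N) ^+ m)).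
    exact: cvg_divnr.
  exact: cvg_expr.
apply: (squeeze_cvge _ Pcalm1 (cvg_cst 1%E)).
by near=> k; rewrite lower/= inner_prob_le1.
Unshelve. all: by end_near. Qed.
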